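(* Let $\Theta\subseteq\mathbb R$ be an open interval containing $0$ and let $(F_\theta)_{\theta\in\Theta}$ be a family of continuous joint cdf's on $\mathbb R^2$ with common marginal cdf's $G$ and $H$ not depending on $\theta$, such that $F_0(x,y)=G(x)H(y)$ for all real $x,y$. Let $\Theta_0\subseteq\Theta$ be a neighborhood of $0$. Suppose that $\mu$ is a finite (nonnegative) measure on the Borel $\sigma$-algebra $\mathcal B(\mathbb R^2)$ and that, for each $\theta\in\Theta_0$, $F_\theta$ is absolutely continuous with respect to $\mu$ with density $f_\theta$, such that $$\limsup_{\theta\to0}\frac{\|f_\theta-f_0\|_\infty}{|\theta|}<\infty,$$ where $\|\cdot\|_\infty$ is the norm on the Lebesgue space $L^\infty(\mathbb R^2,\mu)$. Then $$\frac1\theta\int_{\mathbb R^2}(F_\theta-F_0)\,d(F_\theta-F_0)\to0\quad\text{as }\theta\to0.$$ So, $\mathsf{ARE}_{T,S}(0)=1$ if, in addition, $$\liminf_{\theta\to0}\Big|\frac1\theta\int_{\mathbb R^2}(F_\theta-F_0)\,dF_0\Big|>0.$$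
   Context: Integrals against $dF_0$ and $d(F_\theta-F_0)$ are with respect to the probability measure with cdf $F_0$ and the signed measure which is the difference of the probability measures with cdf's $F_\theta$ and $F_0$; ''$F_\theta$ is absolutely continuous with respect to $\mu$'' means that the probability measure with cdf $F_\theta$ is. $\mathsf{ARE}_{T,S}(0)$ is the (two-sided Pitman) asymptotic relative efficiency, at the independence value $\theta=0$, of Kendall's correlation statistic $T$ relative to Spearman's correlation statistic $S$. With $(X,Y)$ having cdf $F_\theta$ under $\mathsf P_\theta$ (expectation $\mathsf E_\theta$, variance $\mathsf{Var}_\theta$), it is defined by $$\mathsf{ARE}_{T,S}(0):=\frac{\sigma_S^2(0)}{\sigma_T^2(0)}\lim_{\theta\to0}\frac{(\mu_T(\theta)-\mu_T(0))^2}{(\mu_S(\theta)-\mu_S(0))^2},$$ where $\mu_T(\theta)=4\,\mathsf E_\theta F_\theta(X,Y)-1$, $\mu_S(\theta)=12\,\mathsf E_\theta G(X)H(Y)-3$, $\sigma_T^2(\theta)=16\,\mathsf{Var}_\theta\big(2F_\theta(X,Y)-G(X)-H(Y)\big)$, and $$\sigma_S^2(\theta)=144\,\mathsf{Var}_\theta\Big((1-G(X))(1-H(Y))+\int_{\mathbb R}F_\theta(X,y)\,dH(y)+\int_{\mathbb R}F_\theta(x,Y)\,dG(x)\Big).$$ The assertion $\mathsf{ARE}_{T,S}(0)=1$ includes existence of the limit. *)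

(* Defs.v *)
From HB Require Import structures.
From mathcomp Require Import all_boot all_order all_algebra.
From mathcomp Require Import all_classical all_reals all_analysis.
Import Order.TTheory GRing.Theory Num.Theory.
Import numFieldNormedType.Exports.

Set Implicit Arguments.
Unset Strict Implicit.
Unset Printing Implicit Defensive.

Local Open Scope classical_set_scope.
Local Open Scope ring_scope.

Definition is_cdf (R : realType) (Q : probability R R) (G : R -> R) : Prop :=
  forall x : R, Q `]-oo, x]%classic = (G x)%:E.

Definition is_joint_cdf (R : realType) (P : probability (R * R)%type R)
    (F : R * R -> R) : Prop :=
  forall x y : R, P (`]-oo, x]%classic `*` `]-oo, y]%classic) = (F (x, y))%:E.

Definition has_marginal_cdfs (R : realType) (P : probability (R * R)%type R)
    (G H : R -> R) : Prop :=
  (forall x : R, P [set z | z.1 <= x] = (G x)%:E) /\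
  (forall y : R, P [set z | z.2 <= y] = (H y)%:E).

Definition is_density d (T : measurableType d) (R : realType)
    (mu : {measure set T -> \bar R}) (P : probability T R) (f : T -> R) : Prop :=
  measurable_fun [set: T] f /\
  forall A : set T, measurable A -> P A = (\int[mu]_(z in A) (f z)%:E)%E.

(* Integral against a signed measure, through its Jordan decomposition; the
   value does not depend on the chosen Hahn decomposition, by
   Hahn_decomposition_uniq. *)
Definition charge_integral d (T : measurableType d) (R : realType)
    (nu : {charge set T -> \bar R}) (g : T -> R) : R :=
  let exN := svalP (cid (Hahn_decomposition nu)) in
  let PN := svalP (cid exN) in
  \int[jordan_pos PN]_z g z - \int[jordan_neg PN]_z g z.

Definition measure_diff d (T : measurableType d) (R : realType)
    (P Q : {finite_measure set T -> \bar R}) : {charge set T -> \bar R} :=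
  cadd (charge_of_finite_measure P) (copp (charge_of_finite_measure Q)).

(* (X, Y) is realized as the identity of R * R under the law P of cdf F; nuG
   and nuH are the probability measures with cdf's G and H. *)

Definition mu_T (R : realType) (P : probability (R * R)%type R)
    (F : R * R -> R) : R :=
  4 * fine 'E_P[F] - 1.

Definition mu_S (R : realType) (P : probability (R * R)%type R)
    (G H : R -> R) : R :=
  12 * fine 'E_P[fun z => G z.1 * H z.2] - 3.

Definition sigma2_T (R : realType) (P : probability (R * R)%type R)
    (F : R * R -> R) (G H : R -> R) : R :=
  16 * fine 'V_P[fun z => 2 * F z - G z.1 - H z.2].

Definition sigma2_S (R : realType) (P : probability (R * R)%type R)
    (F : R * R -> R) (G H : R -> R) (nuG nuH : probability R R) : R :=
  144 * fine 'V_P[fun z => (1 - G z.1) * (1 - H z.2)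
                           + \int[nuH]_y F (z.1, y) + \int[nuG]_x F (x, z.2)].

Definition ARE_quotient (R : realType) (P : R -> probability (R * R)%type R)
    (F : R -> R * R -> R) (G H : R -> R) (theta : R) : R :=
  (mu_T (P theta) (F theta) - mu_T (P 0) (F 0)) ^+ 2 /
  (mu_S (P theta) G H - mu_S (P 0) G H) ^+ 2.

(* Meaningful only when the limit exists. *)
Definition ARE (R : realType) (P : R -> probability (R * R)%type R)
    (F : R -> R * R -> R) (G H : R -> R) (nuG nuH : probability R R) : R :=
  sigma2_S (P 0) (F 0) G H nuG nuH / sigma2_T (P 0) (F 0) G H *
  lim (ARE_quotient P F G H theta @[theta --> 0^']).

(* Main.v *)
(** Write [nu = P theta - P 0].  The bound on the densities says that
    [|nu A| <= M |theta| mu A] for every measurable [A].  Applied to quadrants it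
    gives [|F theta - F 0| = O(theta)] uniformly, and integrating this against
    [nu], whose total variation is [O(theta)], gives [O(theta ^ 2)].

    Let [D] be the integral of [F theta - F 0] against [P 0] and [E] the integral
    against [nu].  Since the marginals are common and have no atoms, exchanging
    the roles of two independent points drawn from [P theta] and [P 0] shows that
    [F 0] has the same [P theta]-integral as [F theta] has under [P 0].  Hence
    [mu_T theta - mu_T 0 = 4 (2 D + E)] and [mu_S theta - mu_S 0 = 12 D], so the
    quotient of squares tends to [4 / 9] because [E / D] tends to [0].  At
    independence the statistic inside [sigma2_T] is an affine function with slope
    [2] of the one inside [sigma2_S], so the ratio of variances is
    [144 / (16 * 4) = 9 / 4]. *)
Require Import Defs.
From HB Require Import structures.
From mathcomp Require Import all_boot all_order all_algebra.
From mathcomp Require Import all_classical all_reals all_analysis.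
From mathcomp Require Import measurable_realfun ess_sup_inf ring lra.
Import Order.TTheory GRing.Theory Num.Theory.
Import numFieldNormedType.Exports.

Set Implicit Arguments.
Unset Strict Implicit.

Local Open Scope classical_set_scope.
Local Open Scope ring_scope.

(** * Integration against differences of finite measures *)

Lemma adde_cross (R : numDomainType) (p q u v : \bar R) :
  p \is a fin_num -> q \is a fin_num -> u \is a fin_num ->
  v \is a fin_num -> (p - q = u - v -> p + v = q + u)%E.
Proof.
case: p q u v => [p||] [q||] [u||] [v||] // _ _ _ _ [pq].
by congr EFin; rewrite -[p](subrK q) pq -addrA [q + v]addrC addrA subrK addrC.
Qed.

Lemma bounded_integrable d (T : measurableType d) (R : realType)
    (m : {finite_measure set T -> \bar R}) (g : T -> R) (K : R) :
  measurable_fun [set: T] g -> (forall x, `|g x| <= K) ->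
  m.-integrable [set: T] (EFin \o g).
Proof.
move=> mg gK; apply: measurable_bounded_integrable => //.
- by rewrite ltey_eq fin_num_measure.
- by exists K; split; [exact: num_real|move=> M KM x _; exact: le_trans (gK x) (ltW KM)].
Qed.

(** Rearranging the Jordan decomposition of [P - Q] gives an identity between nonnegative measures:
    [P] plus the negative part equals [Q] plus the positive part. A bounded [g] has finite integrals
    against all four, so the integrated identity can be rearranged back. *)
Lemma charge_integral_measure_diff d (T : measurableType d) (R : realType)
    (P Q : {finite_measure set T -> \bar R}) (g : T -> R) (K : R) :
  measurable_fun [set: T] g -> (forall x, `|g x| <= K) ->
  charge_integral (measure_diff P Q) g = \int[P]_x g x - \int[Q]_x g x.
Proof.
move=> mg gK; rewrite /charge_integral.
(* The Hahn sets are picked by [cid], so the identity is proved for an arbitrary decomposition. *)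
suff main A B (PN : hahn_decomposition (measure_diff P Q) A B) :
    \int[jordan_pos PN]_x g x - \int[jordan_neg PN]_x g x =
    \int[P]_x g x - \int[Q]_x g x by exact: main.
have ig (m : {finite_measure set T -> \bar R}) : m.-integrable setT (EFin \o g).
  exact: bounded_integrable gK.
have fin (m : {finite_measure set T -> \bar R}) :
    (\int[m]_x (g x)%:E)%E = (\int[m]_x g x)%:E.
  by rewrite /Rintegral fineK//; apply: integrable_fin_num => //; exact: ig.
have eqm S : measurable S -> S `<=` setT ->
    measure_add P (jordan_neg PN) S = measure_add Q (jordan_pos PN) S.
  move=> mS _; rewrite !measure_addE.
  apply: adde_cross; [exact: fin_num_measure..|].
  transitivity (measure_diff P Q S); first by [].
  by rewrite (jordan_decomp PN mS); congr (_ + _)%E; exact: mulN1e.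
have := eq_measure_integral _ eqm (f := EFin \o g).
rewrite !integral_measure_add//; try exact: ig; try exact/measurable_EFinP.
by rewrite /= !fin -!EFinD => -[]; lra.
Qed.

(** Domination on sets passes to integrals of nonnegative functions, and the integral of [g] against
    [mu] is at most [K] times the total mass. *)
Lemma le_Rintegral_measure_add d (T : measurableType d) (R : realType)
    (P Q mu : {finite_measure set T -> \bar R}) (e : R) (g : T -> R) (K : R) :
  0 <= e ->
  (forall A, measurable A -> (P A <= Q A + e%:E * mu A)%E) ->
  measurable_fun [set: T] g -> (forall x, 0 <= g x <= K) ->
  \int[P]_x g x <= \int[Q]_x g x + e * K * fine (mu setT).
Proof.
move=> e0 PQ mg gK.
have g0 x : 0 <= g x by case/andP: (gK x).
have ig (m : {finite_measure set T -> \bar R}) : m.-integrable setT (EFin \o g).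
  by apply: (@bounded_integrable _ _ _ _ _ K) => // x; rewrite ger0_norm//; case/andP: (gK x).
have fin (m : {finite_measure set T -> \bar R}) :
    (\int[m]_x (g x)%:E)%E = (\int[m]_x g x)%:E.
  by rewrite /Rintegral fineK//; apply: integrable_fin_num => //; exact: ig.
have le A : measurable A ->
    (P A <= measure_add Q (mscale (NngNum e0) mu) A)%E.
  by move=> mA; rewrite measure_addE /mscale/=; exact: PQ.
have := ge0_le_measure_integral le measurableT (f := EFin \o g).
move=> /(_ (fun x => g0 x) (proj2 (measurable_EFinP _ _) mg)).
rewrite ge0_integral_measure_add//; [|try exact/measurable_EFinP; by move=> x _; exact: g0..].
rewrite ge0_integral_mscale//; [|try exact/measurable_EFinP; by move=> x _; exact: g0..].
rewrite /= !fin -EFinM -EFinD lee_fin => /le_trans; apply.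
rewrite lerD2l -mulrA ler_wpM2l//.
rewrite -Rintegral_cst// le_Rintegral//.
- exact: ig.
- exact: finite_measure_integrable_cst.
- by move=> x _; case/andP: (gK x).
Qed.

(** Adding [K] makes [g] nonnegative with upper bound [2 * K], whence the factor 2. The shift
    cancels because [P] and [Q] both have mass 1. *)
Lemma Rintegral_measure_dist_le d (T : measurableType d) (R : realType)
    (P Q : probability T R) (mu : {finite_measure set T -> \bar R}) (e : R)
    (g : T -> R) (K : R) :
  0 <= e ->
  (forall A, measurable A -> (P A <= Q A + e%:E * mu A)%E) ->
  (forall A, measurable A -> (Q A <= P A + e%:E * mu A)%E) ->
  measurable_fun [set: T] g -> (forall x, `|g x| <= K) ->
  `|\int[P]_x g x - \int[Q]_x g x| <= 2 * e * K * fine (mu setT).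
Proof.
move=> e0 PQ QP mg gK.
have ig (m : probability T R) : m.-integrable setT (EFin \o g).
  exact: bounded_integrable gK.
have gK2 x : 0 <= g x + K <= 2 * K.
  by have := gK x; rewrite ler_norml => /andP[]; lra.
have mgK : measurable_fun setT (fun x => g x + K).
  by apply: measurable_funD.
have translate (m : probability T R) : \int[m]_x (g x + K) = \int[m]_x g x + K.
  rewrite RintegralD; [|by []|exact: ig|exact: finite_measure_integrable_cst].
  by rewrite Rintegral_cst// [fine _](congr1 fine (probability_setT m)) mulr1.
have := @le_Rintegral_measure_add _ _ _ P Q mu e _ _ e0 PQ mgK gK2.
have := @le_Rintegral_measure_add _ _ _ Q P mu e _ _ e0 QP mgK gK2.
rewrite !translate ler_norml => h1 h2; apply/andP; split; nra.
Qed.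

(** * Independent pairs and continuous cdf's of random variables *)

(** By Tonelli, both sides are the product measure of [A]. This is the tool for exchanging two
    independent points. *)
Lemma Rintegral_section_swap d1 d2 (T1 : measurableType d1)
    (T2 : measurableType d2) (R : realType)
    (m1 : probability T1 R) (m2 : probability T2 R) (A : set (T1 * T2)) :
  measurable A ->
  \int[m1]_x fine (m2 (xsection A x)) = \int[m2]_y fine (m1 (ysection A y)).
Proof.
move=> mA; have := indic_fubini_tonelli m1 m2 mA.
rewrite indic_fubini_tonelli_FE// indic_fubini_tonelli_GE// /Rintegral => swap.
congr fine; transitivity (\int[m1]_x m2 (xsection A x))%E.
  apply: eq_integral => x _; rewrite fineK// fin_num_measure//.
  exact: measurable_xsection.
rewrite [LHS]swap; apply: eq_integral => y _; rewrite /= fineK// fin_num_measure//.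
exact: measurable_ysection.
Qed.

Lemma measurable_ler d (T : measurableType d) (R : realType) (f g : T -> R) :
  measurable_fun setT f -> measurable_fun setT g ->
  measurable [set x | f x <= g x].
Proof.
move=> mf mg; rewrite -[X in measurable X]setTI.
exact: (measurable_fun_ler mf mg measurableT (Y := [set true])).
Qed.

(** The family [A] is arbitrary so that the lemma serves half-lines of [R] as well as half-planes of
    [R * R]. *)
Lemma cdf_bounded d (T : measurableType d) (R : realType)
    (P : probability T R) (A : R -> set T) (G : R -> R) :
  (forall x, measurable (A x)) -> (forall x, P (A x) = (G x)%:E) ->
  forall x, 0 <= G x <= 1.
Proof.
by move=> mA PG x; rewrite -!lee_fin -PG measure_ge0 probability_le1.
Qed.

Section cdf_of_random_variable.
Context d (T : measurableType d) (R : realType) (P : probability T R).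
Variables (X : T -> R) (G : R -> R).
Hypothesis mX : measurable_fun setT X.
Hypothesis PG : forall x, P [set z | X z <= x] = (G x)%:E.
Hypothesis cG : continuous G.

Let mXle x : measurable [set z | X z <= x].
Proof. by apply: measurable_ler. Qed.

Let mXge x : measurable [set z | x <= X z].
Proof. by apply: measurable_ler. Qed.

Let mXeq x : measurable [set z | X z = x].
Proof.
rewrite (_ : mkset _ = [set z | X z <= x] `&` [set z | x <= X z]).
  exact: measurableI.
apply/seteqP; split => z /=; first by move=> ->.
by move=> [? ?]; apply/eqP; rewrite eq_le; apply/andP.
Qed.

(** An atom of mass [p] at [c] would keep [G x] at least [p] below [G c] for every [x < c], against
    left continuity at [c]. *)
Lemma continuous_cdf_no_atom c : P [set z | X z = c] = 0%E.
Proof.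
have pE := fineK (fin_num_measure P _ (mXeq c)).
set p := fine _ in pE.
have p0 : 0 <= p by rewrite fine_ge0.
have gap x : x < c -> p <= G c - G x.
  move=> xc; rewrite lerBrDr -lee_fin EFinD pE -!PG -measureU//.
    apply: le_measure; rewrite ?inE//; first exact: measurableU.
    by move=> z /= [->//|/le_trans]; apply; exact: ltW.
  by apply/seteqP; split => z //= -[-> /(lt_le_trans xc)]; rewrite ltxx.
rewrite -pE; congr EFin; apply/eqP; rewrite eq_le p0 andbT leNgt.
apply/negP => pgt0.
have /cvgrPdist_lt /(_ _ pgt0) := @cG c.
move=> /nbhs_ballP[e /= e0 He].
have ball_e : ball c e (c - e / 2).
  by rewrite /ball/= opprB addrC subrK gtr0_norm ?divr_gt0// ltr_pdivrMr// ltr_pMr// ltr1n.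
move: (He _ ball_e) => /=.
have /gap : c - e / 2 < c by rewrite ltrBlDr ltrDl divr_gt0.
move=> pG /(le_lt_trans (ler_norm _)).
by rewrite ltNge pG.
Qed.

(** The closed tail and the complement of the closed half-line differ inside [B] by a piece of the
    null set where [X] equals [c]. *)
Lemma continuous_cdf_tail (B : set T) c : measurable B ->
  fine (P (B `&` [set z | c <= X z])) =
  fine (P B) - fine (P (B `&` [set z | X z <= c])).
Proof.
move=> mB.
have -> : P (B `&` [set z | c <= X z]) = P (B `\` [set z | X z <= c]).
  rewrite (measureDI P (A := B `&` [set z | c <= X z]) _ (mXle c)); last first.
    exact: measurableI.
  rewrite [X in (_ + X)%E](_ : _ = 0)%E ?adde0.
    congr (P _); apply/seteqP; split => z /=; first by move=> [[]].
    by move=> [Bz /negP]; rewrite -ltNge => cz; do !split => //;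
      [exact: ltW|apply/negP; rewrite -ltNge].
  apply/eqP; rewrite -measure_le0 -(continuous_cdf_no_atom c).
  apply: le_measure; rewrite ?inE//; first by do !apply: measurableI.
  by move=> z /= [[_ ?] ?]; apply/eqP; rewrite eq_le; apply/andP.
rewrite [in X in X - _](measureDI P mB (mXle c)) fineD ?addrK//.
- by apply: fin_num_measure; exact: measurableD.
- by apply: fin_num_measure; exact: measurableI.
Qed.

(* Exchanging two independent copies of X turns E G(X) into 1 - E G(X). *)
Lemma Rintegral_continuous_cdf : \int[P]_z G (X z) = 2^-1.
Proof.
have mGX : measurable_fun setT (fun z => G (X z)).
  by apply: measurableT_comp => //; exact: continuous_measurable_fun.
have GX z : `|G (X z)| <= 1.
  by have /andP[? ?] := cdf_bounded mXle PG (X z); rewrite ger0_norm.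
have mA : measurable [set zw : T * T | X zw.1 <= X zw.2].
  by apply: measurable_ler; exact: measurableT_comp.
have := Rintegral_section_swap P P mA.
have -> : \int[P]_z fine (P (xsection [set zw | X zw.1 <= X zw.2] z)) =
    \int[P]_z (1 - G (X z)).
  apply: eq_Rintegral => z _.
  rewrite (_ : xsection _ _ = setT `&` [set w | X z <= X w]); last first.
    by rewrite setTI; apply/seteqP; split => w; rewrite /xsection/= inE.
  by rewrite continuous_cdf_tail// setTI PG probability_setT.
have -> : \int[P]_z fine (P (ysection [set zw | X zw.1 <= X zw.2] z)) =
    \int[P]_z G (X z).
  apply: eq_Rintegral => z _.
  rewrite (_ : ysection _ _ = [set w | X w <= X z]) ?PG//.
  by apply/seteqP; split => w; rewrite /ysection/= inE.
rewrite RintegralB//; [|exact: finite_measure_integrable_cst|exact: bounded_integrable GX].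
rewrite Rintegral_cst// [fine _](congr1 fine (probability_setT P))/=; lra.
Qed.

(** Packaging [X] as a random variable gives access to the limits of [cdf] at both infinities. *)
Let RVX : {RV P >-> R} := mfun_Sub (mem_set mX).

Let cdf_RVX : cdf RVX = EFin \o G.
Proof.
apply/funext => r; rewrite /= -PG /cdf /distribution/= /pushforward.
by congr (P _); apply/seteqP; split => z /=; rewrite in_itv.
Qed.

Lemma cdf_exists_lt p : 0 < p -> exists x, G x < p.
Proof.
move=> p0; have := cvg_cdfNy0 RVX; rewrite cdf_RVX => /fine_cvg /cvgr_lt.
by move=> /(_ _ p0) /filter_ex [x]; exists x.
Qed.

Lemma cdf_exists_gt p : p < 1 -> exists x, p < G x.
Proof.
move=> p1; have := cvg_cdfy1 RVX; rewrite cdf_RVX => /fine_cvg /cvgr_gt.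
by move=> /(_ _ p1) /filter_ex [x]; exists x.
Qed.

Lemma continuous_cdf_quantile p : 0 < p < 1 -> exists x, G x = p.
Proof.
move=> /andP[/cdf_exists_lt [a Ga] /cdf_exists_gt [b Gb]].
have ab : a <= b.
  rewrite leNgt; apply/negP => ba; suff : G b <= G a by lra.
  rewrite -lee_fin -!PG; apply: le_measure; rewrite ?inE//.
  by move=> z /= /le_trans; apply; exact: ltW.
have [|x _ <-] := IVT ab (continuous_subspaceT cG) (v := p); last by exists x.
by rewrite ge_min le_max (ltW Ga) (ltW Gb) orbT.
Qed.

End cdf_of_random_variable.

(** * Joint cdf's and the exchange identity *)

(** [F w] is the [P]-measure of the section at [w] of the coordinatewise order, and section measures
    depend measurably on the point. *)
Lemma measurable_joint_cdf (R : realType) (P : probability (R * R)%type R)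
    (F : R * R -> R) : is_joint_cdf P F -> measurable_fun setT F.
Proof.
move=> PF.
pose A := [set zw : (R * R) * (R * R) | zw.1.1 <= zw.2.1 /\ zw.1.2 <= zw.2.2].
have mA : measurable A.
  apply: measurableI; apply: measurable_ler; apply: measurableT_comp => //;
   solve [exact: measurable_fst|exact: measurable_snd].
have := measurable_fun_ysection P mA.
rewrite (_ : _ \o _ = EFin \o F); first by move/measurable_EFinP.
apply/funext => -[x y]; rewrite /= -PF !set_itvE; congr (P _).
by apply/seteqP; split => -[a b]; rewrite /ysection/= inE.
Qed.

Lemma joint_cdf_norm_le1 (R : realType) (P : probability (R * R)%type R)
    (F : R * R -> R) : is_joint_cdf P F -> forall z, `|F z| <= 1.
Proof.
move=> PF [x y]; rewrite ger0_norm -lee_fin -PF ?measure_ge0// probability_le1//.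
exact: measurableX.
Qed.

(* For independent Z ~ P and W ~ Q, the right-hand side is the probability that
   Z is below W in both coordinates, the left-hand side that W is below Z.  By
   inclusion-exclusion the two differ by 1 - E G - E H, and E G = E H = 1/2. *)
Lemma Rintegral_joint_cdf_swap (R : realType)
    (P Q : probability (R * R)%type R) (FP FQ : R * R -> R) (G H : R -> R) :
  is_joint_cdf P FP -> is_joint_cdf Q FQ ->
  has_marginal_cdfs P G H -> has_marginal_cdfs Q G H ->
  continuous G -> continuous H ->
  \int[P]_z FQ z = \int[Q]_z FP z.
Proof.
move=> PF QF [PG PH] [QG QH] cG cH.
have mfst : measurable_fun setT (@fst R R) by exact: measurable_fst.
have msnd : measurable_fun setT (@snd R R) by exact: measurable_snd.
pose A := [set zw : (R * R) * (R * R) | zw.1.1 <= zw.2.1 /\ zw.1.2 <= zw.2.2].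
have mA : measurable A.
  apply: measurableI; apply: measurable_ler; apply: measurableT_comp => //;
   solve [exact: measurable_fst|exact: measurable_snd].
have mle1 x : measurable [set z : R * R | z.1 <= x] by exact: measurable_ler.
have mle2 x : measurable [set z : R * R | z.2 <= x] by exact: measurable_ler.
have mge2 x : measurable [set z : R * R | x <= z.2] by exact: measurable_ler.
have := Rintegral_section_swap P Q mA.
have -> : \int[P]_z fine (Q (xsection A z)) =
    \int[P]_z (1 - G z.1 - H z.2 + FQ z).
  apply: eq_Rintegral => -[x y] _.
  have tail : fine (Q [set w | y <= w.2]) = 1 - H y.
    rewrite -[X in Q X]setTI (continuous_cdf_tail msnd QH cH)//.
    by rewrite setTI QH probability_setT.
  rewrite (_ : xsection _ _ = [set w | y <= w.2] `&` [set w | x <= w.1]); last first.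
    by rewrite setIC; apply/seteqP; split => w; rewrite /xsection/= inE.
  (* The two coordinates are turned around one after the other; the probability becomes
     [(1 - H y) - (G x - FQ (x, y))]. *)
  rewrite (continuous_cdf_tail mfst QG cG)// tail setIC.
  rewrite (continuous_cdf_tail msnd QH cH)// QG.
  by have := QF x y; rewrite !set_itvE => ->/=; lra.
have -> : \int[Q]_z fine (P (ysection A z)) = \int[Q]_z FP z.
  apply: eq_Rintegral => -[x y] _.
  have := PF x y; rewrite !set_itvE => /(congr1 fine)/= <-; congr (fine (P _)).
  by apply/seteqP; split => -[a b]; rewrite /ysection/= inE.
move=> <-.
have iG : P.-integrable setT (EFin \o (fun z => G z.1)).
  apply: (@bounded_integrable _ _ _ _ _ 1).
    by apply: measurableT_comp => //; exact: continuous_measurable_fun.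
  by move=> z; have /andP[? ?] := cdf_bounded mle1 PG z.1; rewrite ger0_norm.
have iH : P.-integrable setT (EFin \o (fun z => H z.2)).
  apply: (@bounded_integrable _ _ _ _ _ 1).
    by apply: measurableT_comp => //; exact: continuous_measurable_fun.
  by move=> z; have /andP[? ?] := cdf_bounded mle2 PH z.2; rewrite ger0_norm.
have i1 : P.-integrable setT (EFin \o cst 1) by exact: finite_measure_integrable_cst.
have iF : P.-integrable setT (EFin \o FQ).
  exact: bounded_integrable (measurable_joint_cdf QF) (joint_cdf_norm_le1 QF).
have iGH := integrableB measurableT i1 iG.
have iGHH := integrableB measurableT iGH iH.
rewrite RintegralD// RintegralB// RintegralB// Rintegral_cst//.
rewrite (Rintegral_continuous_cdf mfst PG cG) (Rintegral_continuous_cdf msnd PH cH).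
rewrite [fine _](congr1 fine (probability_setT P))/=; lra.
Qed.

(** * Bounds near a point from upper and lower limits; comparison of densities *)

Lemma lime_sup_lty_near (R : realType) (h : R -> \bar R) (a : R) :
  (lime_sup h a < +oo)%E ->
  exists2 M : R, 0 <= M & \forall t \near a^', (h t <= M%:E)%E.
Proof.
move=> /ereal_inf_lt [_ [V aV <-]] supV.
(* The maximum with 0 guards against a supremum equal to [-oo] and makes the bound a nonnegative
   real. *)
have [M0 M1] : 0 <= fine (maxe 0%E (ereal_sup (h @` V))) /\
    (ereal_sup (h @` V) <= (fine (maxe 0%E (ereal_sup (h @` V))))%:E)%E.
  have fin : maxe 0%E (ereal_sup (h @` V)) \is a fin_num.
    by rewrite ge0_fin_numE ?gt_max ?ltry ?supV// le_max lexx.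
  by rewrite fineK// fine_ge0 le_max lexx ?orbT.
exists (fine (maxe 0%E (ereal_sup (h @` V)))) => //.
apply: filterS aV => t Vt; apply: le_trans M1.
by apply: ereal_sup_ubound; exists t.
Qed.

Lemma lime_inf_gt0_near (R : realType) (h : R -> \bar R) (a : R) :
  (0 < lime_inf h a)%E ->
  exists2 c : R, 0 < c & \forall t \near a^', (c%:E <= h t)%E.
Proof.
have -> : lime_inf h a = limf_einf h a^' by [].
rewrite limf_einfE => /ereal_sup_gt [_ [V aV <-]] infV.
set m := mine 1%E (ereal_inf (h @` V)).
(* The minimum with 1 makes [m] finite even when the infimum is [+oo]. *)
have m0 : (0 < m)%E by rewrite lt_min lte01 infV.
have mfin : m \is a fin_num.
  by rewrite ge0_fin_numE ?(ltW m0)// gt_min ltry.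
exists (fine m); first by rewrite -lte_fin fineK.
apply: filterS aV => t Vt; rewrite fineK//.
rewrite ge_min; apply/orP; right; apply: ereal_inf_lbound; by exists t.
Qed.

(** Positive total mass selects the essential supremum in the definition of [Lnorm mu +oo]. *)
Lemma Lnormy_le_ae d (T : measurableType d) (R : realType)
    (mu : {measure set T -> \bar R}) (h : T -> R) (M : R) :
  (0 < mu setT)%E -> (Lnorm mu +oo (EFin \o h) <= M%:E)%E ->
  {ae mu, forall z, `|h z| <= M}.
Proof.
rewrite unlock => -> /ess_supP; apply: filterS => z /=.
by rewrite lee_fin.
Qed.

(** [is_density] states neither the sign nor the integrability of [f]. Up to sign, the integrals of
    [f] over the set where it is nonnegative and over the complement are probabilities, so the
    integral of the absolute value is finite. *)
Lemma density_integrable d (T : measurableType d) (R : realType)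
    (mu : {measure set T -> \bar R}) (P : probability T R) (f : T -> R) :
  is_density mu P f -> mu.-integrable setT (EFin \o f).
Proof.
move=> [mf Pf]; apply/integrableP; split; first exact/measurable_EFinP.
have mB : measurable [set x | 0 <= f x] by exact: measurable_ler.
have mC := measurableC mB.
rewrite -(setUv [set x | 0 <= f x]) ge0_integral_setU//; last first.
- by rewrite disj_set2E setICr.
- apply: measurableT_comp => //; apply/measurable_EFinP; exact: measurable_funS mf.
apply: lte_add_pinfty.
  rewrite (eq_integral (fun x => (f x)%:E)); last first.
    by move=> x; rewrite inE /= => fx; rewrite ger0_norm.
  by rewrite -Pf// ltey_eq fin_num_measure.
have fneg x : (~` [set x | 0 <= f x]) x -> f x < 0 by move=> /negP; rewrite -ltNge.
rewrite (eq_integral (fun x => - (f x)%:E)%E); last first.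
  by move=> x; rewrite inE => /fneg fx; rewrite /= ltr0_norm.
rewrite -[X in (X < _)%E]oppeK -integral_ge0N; last first.
  by move=> x /fneg fx; rewrite lee_fin oppr_ge0 ltW.
under eq_integral do rewrite oppeK.
by rewrite -Pf// ltey_eq fin_numN fin_num_measure.
Qed.

(** The exceptional [mu]-null set [N] carries no [P]-mass by absolute continuity; off [N] the
    inequality [f <= g + e] is integrated. *)
Lemma density_dist_le d (T : measurableType d) (R : realType)
    (mu : {finite_measure set T -> \bar R}) (P Q : probability T R)
    (f g : T -> R) (e : R) :
  0 <= e -> P `<< mu -> is_density mu P f -> is_density mu Q g ->
  {ae mu, forall z, `|f z - g z| <= e} ->
  forall A, measurable A -> (P A <= Q A + e%:E * mu A)%E.
Proof.
move=> e0 Pmu fP gQ [N [mN N0 fgN]] A mA.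
have i_f := density_integrable fP; have i_g := density_integrable gQ.
have [[mf Pf] [mg Qg]] := (fP, gQ).
have mAN : measurable (A `\` N) by exact: measurableD.
have i_e : mu.-integrable (A `\` N) (EFin \o cst e).
  exact: finite_measure_integrable_cst.
have PAN : P A = P (A `\` N).
  rewrite (measureDI P mA mN) [X in (_ + X)%E](_ : _ = 0)%E ?adde0//.
  have /null_content_dominatesP Pmu0 := Pmu.
  apply: Pmu0; first exact: measurableI.
  by apply: subset_measure0 N0 => //; exact: measurableI.
have i_fA := integrableS measurableT mAN (@subsetT _ _) i_f.
have i_gA := integrableS measurableT mAN (@subsetT _ _) i_g.
rewrite PAN Pf//; apply: (@le_trans _ _ (\int[mu]_(x in A `\` N) ((g x)%:E + e%:E))%E).
  apply: le_integral => //; first exact: integrableD.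
  move=> x; rewrite inE => -[_ Nx]; rewrite -EFinD lee_fin.
  have : `|f x - g x| <= e by apply: contrapT => ?; apply: Nx; exact: fgN.
  by rewrite ler_norml => /andP[]; lra.
rewrite integralD//= -Qg// integral_cst//.
rewrite leeD// ?lee_wpmul2l ?lee_fin//; apply: le_measure; rewrite ?inE// => x [].
Qed.

(** * Variances *)

Lemma fine_varianceE d (T : measurableType d) (R : realType)
    (P : probability T R) (X : T -> R) :
  fine 'V_P[X] = \int[P]_z (X z - \int[P]_w X w) ^+ 2.
Proof. by rewrite /variance unlock unlock. Qed.

Lemma fine_variance_affine d (T : measurableType d) (R : realType)
    (P : probability T R) (X : T -> R) (K a b : R) :
  measurable_fun setT X -> (forall z, `|X z| <= K) ->
  fine 'V_P[fun z => a * X z + b] = a ^+ 2 * fine 'V_P[X].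
Proof.
move=> mX XK.
have iX : P.-integrable setT (EFin \o X) by exact: bounded_integrable XK.
have iaX : P.-integrable setT (EFin \o (fun z => a * X z)).
  apply: (@bounded_integrable _ _ _ _ _ (`|a| * K)); first exact: measurable_funM.
  by move=> z; rewrite normrM ler_wpM2l.
rewrite !fine_varianceE RintegralD//; last exact: finite_measure_integrable_cst.
rewrite RintegralZl// Rintegral_cst// [fine _](congr1 fine (probability_setT P)) mulr1.
rewrite -[RHS]RintegralZl//.
  by apply: eq_Rintegral => z _; ring.
set c := \int[P]_w X w.
apply: (@bounded_integrable _ _ _ _ _ ((K + `|c|) ^+ 2)).
  by apply: measurable_funX; exact: measurable_funB.
move=> z; rewrite normrX ler_sqr ?nnegrE ?addr_ge0//.
  by rewrite (le_trans (ler_normB _ _))// lerD2r.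
exact: le_trans (XK z).
Qed.

(** A form of Markov's inequality; the upper bound [K] provides integrability. *)
Lemma Rintegral_ge_measure d (T : measurableType d) (R : realType)
    (m : {finite_measure set T -> \bar R}) (g : T -> R) (K k : R) (A : set T) :
  measurable A -> measurable_fun setT g -> (forall z, 0 <= g z <= K) ->
  (forall z, A z -> k <= g z) -> k * fine (m A) <= \int[m]_z g z.
Proof.
move=> mA mg gK kg; have g0 z : 0 <= g z by case/andP: (gK z).
have ig : m.-integrable setT (EFin \o g).
  by apply: (@bounded_integrable _ _ _ _ _ K) => // z; rewrite ger0_norm//; case/andP: (gK z).
have igA := integrableS measurableT mA (@subsetT _ A) ig.
apply: (@le_trans _ _ (\int[m]_(z in A) g z)).
  rewrite -Rintegral_cst// le_Rintegral//; exact: finite_measure_integrable_cst.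
apply: fine_le; rewrite ?integrable_fin_num//.
apply: ge0_subset_integral => //; first exact/measurable_EFinP.
by move=> z _; rewrite lee_fin.
Qed.

(** At independence both asymptotic variances are multiples of this one, so its positivity keeps
    their ratio from being [0 / 0]. *)
Lemma independent_variance_gt0 (R : realType)
    (P : probability (R * R)%type R) (G H : R -> R) :
  has_marginal_cdfs P G H -> is_joint_cdf P (fun z => G z.1 * H z.2) ->
  continuous G -> continuous H ->
  0 < fine 'V_P[fun z => (1 - G z.1) * (1 - H z.2) + G z.1 / 2 + H z.2 / 2].
Proof.
move=> [PG PH] PGH cG cH; rewrite fine_varianceE.
pose S := fun z : R * R => (1 - G z.1) * (1 - H z.2) + G z.1 / 2 + H z.2 / 2.
pose c := \int[P]_z S z.
rewrite -[ltRHS]/(\int[P]_z (S z - c) ^+ 2).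
have mfst : measurable_fun setT (@fst R R) by exact: measurable_fst.
have msnd : measurable_fun setT (@snd R R) by exact: measurable_snd.
have mle1 x : measurable [set z : R * R | z.1 <= x] by exact: measurable_ler.
have mle2 x : measurable [set z : R * R | z.2 <= x] by exact: measurable_ler.
have mge2 x : measurable [set z : R * R | x <= z.2] by exact: measurable_ler.
have G01 := cdf_bounded mle1 PG; have H01 := cdf_bounded mle2 PH.
have mG : measurable_fun setT (fun z : R * R => G z.1).
  by apply: measurableT_comp => //; exact: continuous_measurable_fun.
have mH : measurable_fun setT (fun z : R * R => H z.2).
  by apply: measurableT_comp => //; exact: continuous_measurable_fun.
have mS : measurable_fun setT S.
  apply: measurable_funD; last by apply: measurable_funM.
  apply: measurable_funD; last by apply: measurable_funM.
  by apply: measurable_funM; apply: measurable_funB.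
have Sb z : 0 <= S z <= 2.
  have := G01 z.1; have := H01 z.2; rewrite /S.
  by move: (G _) (H _) => u v /andP[? ?] /andP[? ?]; apply/andP; split; nra.
have Gle x y : x <= y -> G x <= G y.
  move=> xy; rewrite -lee_fin -!PG; apply: le_measure; rewrite ?inE//.
  by move=> z /= /le_trans; exact.
have Hle x y : x <= y -> H x <= H y.
  move=> xy; rewrite -lee_fin -!PH; apply: le_measure; rewrite ?inE//.
  by move=> z /= /le_trans; exact.
(* S - 3/4 = (G - 1/2) (H - 1/2) is at least 1/16 on one set of probability
   1/16 and at most -1/16 on another, so S is not almost surely equal to c. *)
have [a Ga] : exists a, G a = 4^-1.
  by apply: (continuous_cdf_quantile mfst PG cG); lra.
have [b Hb] : exists b, H b = 4^-1.
  by apply: (continuous_cdf_quantile msnd PH cH); lra.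
have [b' Hb'] : exists b, H b = 3 / 4.
  by apply: (continuous_cdf_quantile msnd PH cH); lra.
have P1 : fine (P ([set z | z.1 <= a] `&` [set z | z.2 <= b])) = 16^-1.
  by have := PGH a b; rewrite !set_itvE /= Ga Hb => ->/=; lra.
have P2 : fine (P ([set z | z.1 <= a] `&` [set z | b' <= z.2])) = 16^-1.
  rewrite (continuous_cdf_tail msnd PH cH)// PG.
  by have := PGH a b'; rewrite !set_itvE /= Ga Hb' => ->/=; lra.
have bnd z : 0 <= (S z - c) ^+ 2 <= (2 + `|c|) ^+ 2.
  rewrite sqr_ge0/= -[leLHS]ger0_norm ?sqr_ge0// normrX ler_sqr ?nnegrE ?addr_ge0//.
  rewrite (le_trans (ler_normB _ _))// lerD2r ger0_norm; by case/andP: (Sb z).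
have mSc : measurable_fun setT (fun z => (S z - c) ^+ 2).
  by apply: measurable_funX; exact: measurable_funB.
(* [256^-1] is the square of the gap 1/16. Whichever side of 3/4 the mean [c] lies on, one of the
   two sets of mass 1/16 keeps [S] at least that far from [c]. *)
apply: (@lt_le_trans _ _ (256^-1 * 16^-1)); first by rewrite mulr_gt0.
have [c34|c34] := leP c (3 / 4).
  rewrite -P1; apply: (@Rintegral_ge_measure _ _ _ P _ _ _ _ _ mSc bnd); first exact: measurableI.
  move=> z [/= /Gle + /Hle]; rewrite Ga Hb /S.
  move: (G _) (H _) => u v ? ?.
  have : 16^-1 <= (u - 1 / 2) * (v - 1 / 2) by nra.
  by nra.
rewrite -P2; apply: (@Rintegral_ge_measure _ _ _ P _ _ _ _ _ mSc bnd); first exact: measurableI.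
move=> z [/= /Gle + /Hle]; rewrite Ga Hb' /S.
move: (G _) (H _) => u v ? ?.
have : (u - 1 / 2) * (v - 1 / 2) <= - 16^-1 by nra.
by nra.
Qed.

(** * Continuity of the marginals, and a squeeze at 0 *)

(** Continuity is given for the joint cdf; at independence a horizontal section with nonzero factor
    [H y] transfers it to [G]. *)
Lemma continuous_left_factor (R : realType) (F : R * R -> R) (G H : R -> R) y :
  continuous F -> (forall x y, F (x, y) = G x * H y) -> H y != 0 ->
  continuous G.
Proof.
move=> cF FGH Hy; rewrite (_ : G = fun x => F (x, y) / H y); last first.
  by apply/funext => x; rewrite FGH mulfK.
move=> x; have cFx : F (t, y) @[t --> x] --> F (x, y).
  apply: (@continuous2_cvg _ _ _ _ (nbhs x) _ id (fun=> y) (fun a b => F (a, b)) x y); [|exact: cvg_id|exact: cvg_cst].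
  rewrite (_ : (fun z => _) = F); [exact: cF|by apply/funext => -[]].
exact: cvgM cFx (cvg_cst _).
Qed.

Lemma continuous_right_factor (R : realType) (F : R * R -> R) (G H : R -> R) x :
  continuous F -> (forall x y, F (x, y) = G x * H y) -> G x != 0 ->
  continuous H.
Proof.
move=> cF FGH Gx; rewrite (_ : H = fun y => F (x, y) / G x); last first.
  by apply/funext => y; rewrite FGH mulrAC mulfV// mul1r.
move=> y; have cFy : F (x, t) @[t --> y] --> F (x, y).
  apply: (@continuous2_cvg _ _ _ _ (nbhs y) _ (fun=> x) id (fun a b => F (a, b)) x y); [|exact: cvg_cst|exact: cvg_id].
  rewrite (_ : (fun z => _) = F); [exact: cF|by apply/funext => -[]].
exact: cvgM cFy (cvg_cst _).
Qed.

Lemma cvg0_linear_bound (R : realType) (h : R -> R) (C : R) :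
  (\forall t \near 0^', `|h t| <= C * `|t|) -> h t @[t --> 0^'] --> (0 : R).
Proof.
move=> hC; apply/norm_cvg0P.
apply: (@squeeze_cvgr _ _ _ _ (fun=> 0) (fun t => C * `|t|)).
- by near=> t; rewrite normr_ge0/=; near: t.
- exact: cvg_cst.
rewrite -[X in _ --> X](mulr0 C); apply: cvgM; first exact: cvg_cst.
rewrite -[X in _ --> X](@normr0 _ R); apply: cvg_norm.
exact: nbhs_dnbhs.
Unshelve. all: by end_near. Qed.

(** * Quadratic bound for the signed integral *)

Lemma joint_cdf_dist_le (R : realType) (P Q : probability (R * R)%type R)
    (mu : {finite_measure set (R * R)%type -> \bar R}) (FP FQ : R * R -> R)
    (e : R) : 0 <= e ->
  is_joint_cdf P FP -> is_joint_cdf Q FQ ->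
  (forall A, measurable A -> (P A <= Q A + e%:E * mu A)%E) ->
  (forall A, measurable A -> (Q A <= P A + e%:E * mu A)%E) ->
  forall z, `|FP z - FQ z| <= e * fine (mu setT).
Proof.
move=> e0 PF QF PQ QP [x y].
have mA : measurable (`]-oo, x]%classic `*` `]-oo, y]%classic : set (R * R)%type).
  exact: measurableX.
have muE := fineK (fin_num_measure mu setT measurableT).
have le (a b : R) : (a%:E <= b%:E + e%:E * mu (`]-oo, x]%classic `*` `]-oo, y]%classic))%E ->
    a - b <= e * fine (mu setT).
  move=> ab; rewrite lerBlDl -lee_fin EFinD EFinM muE (le_trans ab)//.
  by rewrite leeD2l// lee_wpmul2l ?lee_fin// le_measure ?inE.
rewrite ler_norml lerNl opprB; apply/andP; split; apply: le.
- by rewrite -PF -QF; exact: QP.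
- by rewrite -PF -QF; exact: PQ.
Qed.

Lemma joint_cdf_diff_integral_le (R : realType)
    (P Q : probability (R * R)%type R)
    (mu : {finite_measure set (R * R)%type -> \bar R}) (FP FQ : R * R -> R)
    (e : R) : 0 <= e ->
  is_joint_cdf P FP -> is_joint_cdf Q FQ ->
  (forall A, measurable A -> (P A <= Q A + e%:E * mu A)%E) ->
  (forall A, measurable A -> (Q A <= P A + e%:E * mu A)%E) ->
  `|charge_integral (measure_diff P Q) (fun z => FP z - FQ z)| <=
  2 * fine (mu setT) ^+ 2 * e ^+ 2.
Proof.
move=> e0 PF QF PQ QP.
have dF := joint_cdf_dist_le e0 PF QF PQ QP.
have mdF : measurable_fun setT (fun z => FP z - FQ z).
  apply: measurable_funB; [exact: measurable_joint_cdf PF|exact: measurable_joint_cdf QF].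
rewrite (charge_integral_measure_diff _ _ mdF dF).
(* Here [K] is [e * fine (mu setT)], which supplies the second factor [e] and the second total
   mass. *)
apply: le_trans (Rintegral_measure_dist_le e0 PQ QP mdF dF) _.
by rewrite le_eqVlt; apply/orP; left; apply/eqP; ring.
Qed.

(** * Means and variances of the two statistics *)

(** Write [D] for the [Q]-integral of [FP - FQ] and [E] for the signed one. Its [P]-integral is
    [D + E], and by the exchange identity the change of measure in the integral of [FQ] contributes
    another [D]. *)
Lemma muT_diff (R : realType) (P Q : probability (R * R)%type R)
    (FP FQ : R * R -> R) (G H : R -> R) :
  is_joint_cdf P FP -> is_joint_cdf Q FQ ->
  has_marginal_cdfs P G H -> has_marginal_cdfs Q G H ->
  continuous G -> continuous H ->
  mu_T P FP - mu_T Q FQ =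
  4 * (2 * \int[Q]_z (FP z - FQ z) +
       charge_integral (measure_diff P Q) (fun z => FP z - FQ z)).
Proof.
move=> PF QF PGH QGH cG cH.
have mP := measurable_joint_cdf PF; have mQ := measurable_joint_cdf QF.
have dF z : `|FP z - FQ z| <= 2.
  rewrite (le_trans (ler_normB _ _))// (_ : 2 = 1 + 1)// lerD//.
    exact: joint_cdf_norm_le1 PF _.
  exact: joint_cdf_norm_le1 QF _.
have mdF : measurable_fun setT (fun z => FP z - FQ z) by exact: measurable_funB.
have -> : charge_integral (measure_diff P Q) (fun z => FP z - FQ z) =
    \int[P]_z (FP z - FQ z) - \int[Q]_z (FP z - FQ z).
  exact: charge_integral_measure_diff dF.
have iP (m : probability (R * R)%type R) : m.-integrable setT (EFin \o FP).
  exact: bounded_integrable mP (joint_cdf_norm_le1 PF).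
have iQ (m : probability (R * R)%type R) : m.-integrable setT (EFin \o FQ).
  exact: bounded_integrable mQ (joint_cdf_norm_le1 QF).
have swap := Rintegral_joint_cdf_swap PF QF PGH QGH cG cH.
have dE (m : probability (R * R)%type R) :
    \int[m]_z (FP z - FQ z) = \int[m]_z FP z - \int[m]_z FQ z.
  exact: RintegralB measurableT (iP m) (iQ m).
by rewrite !dE swap /mu_T unlock -!/(Rintegral _ _ _); lra.
Qed.

(** At independence the integrand [G z.1 * H z.2] is [FQ] itself, so the exchange identity turns its
    [P]-integral into the [Q]-integral of [FP]. *)
Lemma muS_diff (R : realType) (P Q : probability (R * R)%type R)
    (FP FQ : R * R -> R) (G H : R -> R) :
  is_joint_cdf P FP -> is_joint_cdf Q FQ ->
  has_marginal_cdfs P G H -> has_marginal_cdfs Q G H ->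
  continuous G -> continuous H -> (forall x y, FQ (x, y) = G x * H y) ->
  mu_S P G H - mu_S Q G H = 12 * \int[Q]_z (FP z - FQ z).
Proof.
move=> PF QF PGH QGH cG cH FQE.
have mP := measurable_joint_cdf PF; have mQ := measurable_joint_cdf QF.
have iP : Q.-integrable setT (EFin \o FP) by exact: bounded_integrable mP (joint_cdf_norm_le1 PF).
have iQ : Q.-integrable setT (EFin \o FQ) by exact: bounded_integrable mQ (joint_cdf_norm_le1 QF).
have swap := Rintegral_joint_cdf_swap PF QF PGH QGH cG cH.
have GHE : (fun z : R * R => G z.1 * H z.2) = FQ.
  by apply/funext => -[x y]; rewrite FQE.
by rewrite RintegralB// -swap /mu_S GHE unlock -!/(Rintegral _ _ _); lra.
Qed.

Lemma sigma2_ratio (R : realType) (P : probability (R * R)%type R)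
    (F : R * R -> R) (G H : R -> R) (nuG nuH : probability R R) :
  is_joint_cdf P F -> has_marginal_cdfs P G H ->
  is_cdf nuG G -> is_cdf nuH H -> continuous G -> continuous H ->
  (forall x y, F (x, y) = G x * H y) ->
  sigma2_S P F G H nuG nuH / sigma2_T P F G H = 9 / 4.
Proof.
move=> PF PGH nG nH cG cH FGH.
(* [G] and [H] are the cdf's of the random variable [id] under [nuG] and [nuH]; their means 1/2
   evaluate the inner integrals of [sigma2_S]. *)
have mid : measurable_fun [set: R] id by exact: measurable_id.
have nG' x : nuG [set z | id z <= x] = (G x)%:E by rewrite -nG set_itvE.
have nH' x : nuH [set z | id z <= x] = (H x)%:E by rewrite -nH set_itvE.
have mle (x : R) : measurable [set z : R | z <= x] by exact: measurable_ler.
have G01 := cdf_bounded mle nG'; have H01 := cdf_bounded mle nH'.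
have iG : nuG.-integrable setT (EFin \o G).
  apply: (@bounded_integrable _ _ _ _ _ 1); first exact: continuous_measurable_fun.
  by move=> z; case/andP: (G01 z) => ? ?; rewrite ger0_norm.
have iH : nuH.-integrable setT (EFin \o H).
  apply: (@bounded_integrable _ _ _ _ _ 1); first exact: continuous_measurable_fun.
  by move=> z; case/andP: (H01 z) => ? ?; rewrite ger0_norm.
pose S := fun z : R * R => (1 - G z.1) * (1 - H z.2) + G z.1 / 2 + H z.2 / 2.
have SE : (fun z : R * R => (1 - G z.1) * (1 - H z.2)
    + \int[nuH]_y F (z.1, y) + \int[nuG]_x F (x, z.2)) = S.
  apply/funext => z; rewrite /S; congr (_ + _ + _).
    under eq_Rintegral do rewrite FGH.
    by rewrite RintegralZl// (Rintegral_continuous_cdf mid nH' cH).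
  under eq_Rintegral do rewrite FGH.
  by rewrite RintegralZr// (Rintegral_continuous_cdf mid nG' cG) mulrC.
have TE : (fun z : R * R => 2 * F z - G z.1 - H z.2) = (fun z => 2 * S z + -2).
  by apply/funext => -[x y]; rewrite FGH /S/=; field.
have mG : measurable_fun setT (fun z : R * R => G z.1).
  by apply: measurableT_comp => //; exact: continuous_measurable_fun.
have mH : measurable_fun setT (fun z : R * R => H z.2).
  by apply: measurableT_comp => //; exact: continuous_measurable_fun.
have mS : measurable_fun setT S.
  apply: measurable_funD; last by apply: measurable_funM.
  apply: measurable_funD; last by apply: measurable_funM.
  by apply: measurable_funM; apply: measurable_funB.
have Sb z : `|S z| <= 2.
  have := G01 z.1; have := H01 z.2; rewrite /S ler_norml.
  by move: (G _) (H _) => u v /andP[? ?] /andP[? ?]; apply/andP; split; nra.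
have PFGH : is_joint_cdf P (fun z => G z.1 * H z.2) by move=> x y; rewrite PF FGH.
have V0 := independent_variance_gt0 PGH PFGH cG cH.
rewrite /sigma2_S /sigma2_T SE TE (fine_variance_affine _ 2 (-2) mS Sb).
rewrite -/S in V0; have := lt0r_neq0 V0 => Vn0.
by field.
Qed.

(** * Assembly of the two limits *)

Unset Implicit Arguments.

Theorem proposition4p5 (R : realType) (Theta : set R)
    (P : R -> probability (R * R)%type R) (F : R -> R * R -> R)
    (nuG nuH : probability R R) (G H : R -> R)
    (Theta_open : open Theta) (Theta_itv : is_interval Theta)
    (Theta_has0 : Theta 0)
    (F_cdf : forall theta, Theta theta -> is_joint_cdf (P theta) (F theta))
    (F_cont : forall theta, Theta theta -> continuous (F theta))
    (G_cdf : is_cdf nuG G) (H_cdf : is_cdf nuH H)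
    (F_marg : forall theta, Theta theta -> has_marginal_cdfs (P theta) G H)
    (F0_indep : forall x y : R, F 0 (x, y) = G x * H y)
    (Theta0 : set R) (Theta0_sub : Theta0 `<=` Theta)
    (Theta0_nbhs : nbhs (0 : R) Theta0)
    (mu : {finite_measure set (R * R)%type -> \bar R})
    (f : R -> R * R -> R)
    (F_ac : forall theta, Theta0 theta -> P theta `<< mu)
    (F_density : forall theta, Theta0 theta ->
      is_density mu (P theta) (f theta))
    (f_limsup : (lime_sup (fun theta : R =>
        Lnorm mu +oo (fun z => (f theta z - f 0%R z)%R%:E) *
          (`|theta|^-1)%:E) 0%R
      < +oo)%E) :
  (theta^-1 * charge_integral (measure_diff (P theta) (P 0))
                (fun z => F theta z - F 0 z)) @[theta --> 0^'] --> (0 : R)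
  /\
  ((0 < lime_inf (fun theta : R =>
      (`| theta^-1 * \int[P 0%R]_z (F theta z - F 0%R z) |)%R%:E) 0%R)%E ->
   cvg (ARE_quotient P F G H theta @[theta --> 0^']) /\
   ARE P F G H nuG nuH = 1).
Proof.
have T00 : Theta0 0 by exact: nbhs_singleton.
have mfst : measurable_fun setT (@fst R R) by exact: measurable_fst.
have msnd : measurable_fun setT (@snd R R) by exact: measurable_snd.
have [PG PH] := F_marg 0 Theta_has0.
(* Points with [G x0] and [H y0] positive give the nonzero factors needed for continuity of the
   marginals. *)
have [x0 Gx0] := cdf_exists_gt mfst PG (@ltr01 R).
have [y0 Hy0] := cdf_exists_gt msnd PH (@ltr01 R).
have cG : continuous G.
  by apply: (continuous_left_factor (F_cont 0 Theta_has0) F0_indep (y := y0)); rewrite gt_eqF.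
have cH : continuous H.
  by apply: (continuous_right_factor (F_cont 0 Theta_has0) F0_indep (x := x0)); rewrite gt_eqF.
have mu_gt0 : (0 < mu setT)%E.
  rewrite lt0e measure_ge0 andbT; apply/eqP => mu0.
  have /null_content_dominatesP /(_ setT measurableT mu0) := F_ac 0 T00.
  by rewrite probability_setT => /eqP; rewrite onee_eq0.
have [M M0 fM] := lime_sup_lty_near f_limsup.
pose E theta := charge_integral (measure_diff (P theta) (P 0))
  (fun z => F theta z - F 0 z).
(* The constant of [joint_cdf_diff_integral_le] at [e = M * |theta|], with [|theta| ^ 2] split
   off. *)
pose C := 2 * fine (mu setT) ^+ 2 * M ^+ 2.
have C0 : 0 <= C by apply: mulr_ge0; [apply: mulr_ge0|]; rewrite ?sqr_ge0.
have near_Theta0 : \forall theta \near 0^', Theta0 theta by exact: nbhs_dnbhs.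
have E_le : \forall theta \near 0^', `|E theta| <= C * `|theta| ^+ 2.
  near=> theta.
  have T0 : Theta0 theta by near: theta.
  have theta0 : theta != 0 by near: theta; exact: nbhs_dnbhs_neq.
  have e0 : 0 <= M * `|theta| by rewrite mulr_ge0.
  have fdist : {ae mu, forall z, `|f theta z - f 0 z| <= M * `|theta|}.
    apply: Lnormy_le_ae => //.
    have : (Lnorm mu +oo (fun z => (f theta z - f 0%R z)%R%:E) *
          (`|theta|^-1)%:E <= M%:E)%E by near: theta.
    by rewrite EFinM lee_pdivrMr ?normr_gt0.
  have gdist : {ae mu, forall z, `|f 0 z - f theta z| <= M * `|theta|}.
    by apply: filterS fdist => z; rewrite distrC.
  rewrite /C -mulrA -exprMn_comm//; last exact: mulrC.
  apply: joint_cdf_diff_integral_le => //.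
  - by apply: F_cdf; exact: Theta0_sub.
  - exact: F_cdf.
  - exact: density_dist_le (F_ac _ T0) (F_density _ T0) (F_density _ T00) fdist.
  - exact: density_dist_le (F_ac _ T00) (F_density _ T00) (F_density _ T0) gdist.
split.
  apply: (@cvg0_linear_bound _ _ C); near=> theta.
  have theta0 : theta != 0 by near: theta; exact: nbhs_dnbhs_neq.
  rewrite normrM normfV mulrC ler_pdivrMr ?normr_gt0// -mulrA -expr2.
  by near: theta.
move=> /lime_inf_gt0_near [c c0 cD].
pose D theta := \int[P 0]_z (F theta z - F 0 z).
(* The lower limit gives [|D theta| >= c * |theta|], while [|E theta|] is at most [C * |theta| ^ 2];
   the ratio is therefore at most [C / c * |theta|]. *)
have ED0 : E theta / D theta @[theta --> 0^'] --> (0 : R).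
  apply: (@cvg0_linear_bound _ _ (C / c)); near=> theta.
  have theta0 : theta != 0 by near: theta; exact: nbhs_dnbhs_neq.
  have Dge : c * `|theta| <= `|D theta|.
    have : (c%:E <= (`|theta^-1 * D theta|)%:E)%E by near: theta.
    by rewrite lee_fin normrM normfV mulrC ler_pdivlMr ?normr_gt0.
  have Ele : `|E theta| <= C * `|theta| ^+ 2 by near: theta.
  have D0 : 0 < `|D theta| by rewrite (lt_le_trans _ Dge)// mulr_gt0// normr_gt0.
  rewrite normrM normfV ler_pdivrMr//; apply: le_trans Ele _.
  have -> : C * `|theta| ^+ 2 = C / c * `|theta| * (c * `|theta|).
    by field; rewrite gt_eqF.
  by apply: ler_wpM2l => //; rewrite mulr_ge0// divr_ge0// ltW.
have quot : ARE_quotient P F G H theta @[theta --> 0^'] --> (4 / 9 : R).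
  (* Where [D theta] is nonzero, the quotient [(4 * (2 * D + E)) ^ 2 / (12 * D) ^ 2] is this
     expression. *)
  have lim49 : 9^-1 * (2 + E theta / D theta) ^+ 2 @[theta --> 0^'] --> (4 / 9 : R).
    have -> : 4 / 9 = 9^-1 * (2 + 0) ^+ 2 :> R by field.
    apply: cvgM; first exact: cvg_cst.
    rewrite expr2; under eq_fun do rewrite expr2.
    by apply: cvgM; (apply: cvgD; [exact: cvg_cst|]).
  apply: cvg_trans lim49; apply: near_eq_cvg; near=> theta.
  have theta0 : theta != 0 by near: theta; exact: nbhs_dnbhs_neq.
  have Ttheta : Theta theta by apply: Theta0_sub; near: theta.
  have D0 : D theta != 0.
    have : (c%:E <= (`|theta^-1 * D theta|)%:E)%E by near: theta.
    rewrite lee_fin => /(lt_le_trans c0); rewrite normr_gt0.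
    by rewrite mulf_eq0 => /norP[].
  rewrite /ARE_quotient (muT_diff (F_cdf _ Ttheta) (F_cdf _ Theta_has0)
    (F_marg _ Ttheta) (F_marg _ Theta_has0) cG cH).
  rewrite (muS_diff (F_cdf _ Ttheta) (F_cdf _ Theta_has0)
    (F_marg _ Ttheta) (F_marg _ Theta_has0) cG cH F0_indep).
  rewrite -/(D theta) -/(E theta); field.
  by rewrite D0.
(* Existence of the limit gives [lim] its meaning in [ARE], whose value is then
   [9 / 4 * (4 / 9)]. *)
split; first by apply/cvg_ex; exists (4 / 9).
rewrite /ARE (sigma2_ratio (F_cdf _ Theta_has0) (F_marg _ Theta_has0)) //.
by rewrite (cvg_lim _ quot)//; field.
Unshelve. all: by end_near. Qed.
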